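(* Let $n_X,n_Y,n_B,n_A$ be positive integers. For the prepare-and-measure scenario $(n_X;n_Y,n_B)$, a behavior $\mathbf q=[q(b|xy)]$ can be realized with an $n_A$-dimensional classical message and adaptive non-signaling assistance, i.e. $\mathbf q\in\mathrm{NS}^{\mathrm A}(n_X;n_Y,n_B)_{n_A}$, if and only if $$\sum_{b=0}^{n_B-1}\max_{x\in[n_X]}q(b|xy)\le n_A\qquad\forall y\in[n_Y].$$ In other words, $\mathrm{NS}^{\mathrm A}(n_X;n_Y,n_B)_{n_A}=\mathcal G(n_X;n_Y,n_B)_{n_A}$.
   Context: For a positive integer $n$, $[n]:=\{0,1,\dots,n-1\}$. Behavior: a behavior of the prepare-and-measure (PM) scenario $(n_X;n_Y,n_B)$ is a family $\mathbf q=[q(b|xy)]$ of real numbers, $b\in[n_B]$, $x\in[n_X]$, $y\in[n_Y]$, with $q(b|xy)\ge 0$ and $\sum_b q(b|xy)=1$ for all $x,y$. Non-signaling (NS) box: for finite input and output sets, a bipartite NS box is a family of conditional probability distributions $p(\alpha\beta|\xi\eta)$ (Alice: input $\xi$, output $\alpha$; Bob: input $\eta$, output $\beta$) such that $\sum_\beta p(\alpha\beta|\xi\eta)$ does not depend on $\eta$ and $\sum_\alpha p(\alpha\beta|\xi\eta)$ does not depend on $\xi$. Adaptive NS-assisted set: $\mathrm{NS}^{\mathrm A}(n_X;n_Y,n_B)_{n_A}$ is the set of behaviors of $(n_X;n_Y,n_B)$ of the form $q(b|xy)=\sum_{a=0}^{n_A-1}p(ab|x,(y,z=a))$, where $p(ab|x,(y,z))$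 is a bipartite NS box (Alice: input $x\in[n_X]$, output $a\in[n_A]$; Bob: input the pair $(y,z)\in[n_Y]\times[n_A]$, output $b\in[n_B]$). $\mathcal G(n_X;n_Y,n_B)_{n_A}$ is the set of all behaviors of $(n_X;n_Y,n_B)$ satisfying $\sum_{b=0}^{n_B-1}\max_{x\in[n_X]}q(b|xy)\le n_A$ for all $y\in[n_Y]$. *)

(* Defs.v *)
From HB Require Import structures.
From mathcomp Require Import all_boot all_order all_algebra.
From mathcomp Require Import boolp classical_sets reals.

Set Implicit Arguments.
Unset Strict Implicit.
Unset Printing Implicit Defensive.

Import Order.TTheory GRing.Theory Num.Theory.
Local Open Scope ring_scope.

(* q b x y stands for q(b|xy). *)
Definition pm_family (R : realType) (nX nY nB : nat) : Type :=
  'I_nB -> 'I_nX -> 'I_nY -> R.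

Definition is_behavior (R : realType) (nX nY nB : nat)
    (q : pm_family R nX nY nB) : Prop :=
  (forall b x y, 0 <= q b x y) /\ (forall x y, \sum_b q b x y = 1).

(* p a b x y stands for p(ab|xy): x, a are Alice's input and output, y, b are
   Bob's. *)
Definition is_NS_box (R : realType) (X A Y B : finType)
    (p : A -> B -> X -> Y -> R) : Prop :=
  [/\ forall a b x y, 0 <= p a b x y,
      forall x y, \sum_a \sum_b p a b x y = 1,
      forall a x y y', \sum_b p a b x y = \sum_b p a b x y' &
      forall b y x x', \sum_a p a b x y = \sum_a p a b x' y].

(* Bob's input is the pair (y, z), where z is set to the message a. *)
Definition NS_adaptive (R : realType) (nX nY nB nA : nat) :
    set (pm_family R nX nY nB) :=
  [set q | is_behavior q /\
     exists p : 'I_nA -> 'I_nB -> 'I_nX -> 'I_nY * 'I_nA -> R,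
       is_NS_box p /\
       forall b x y, q b x y = \sum_(a < nA) p a b x (y, a)]%classic.

(* The base value 0 does not affect the maximum when nX > 0 and q >= 0, as is
   the case for behaviors. *)
Definition guess_bound (R : realType) (nX nY nB nA : nat)
    (q : pm_family R nX nY nB) : Prop :=
  forall y : 'I_nY,
    \sum_(b < nB) \big[Num.max/0]_(x < nX) q b x y <= nA%:R.

Definition Gset (R : realType) (nX nY nB nA : nat) :
    set (pm_family R nX nY nB) :=
  [set q | is_behavior q /\ guess_bound nA q]%classic.

Arguments NS_adaptive : clear implicits.
Arguments Gset : clear implicits.

(* Main.v *)
Require Import Defs.
From mathcomp Require Import all_boot all_order all_algebra.
From mathcomp Require Import boolp classical_sets reals.

Import Order.TTheory GRing.Theory Num.Theory.
Local Open Scope ring_scope.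

(** Necessity: [q(b|xy)] is at most the sum over the messages [a] of Bob's
    marginals [p(b|(y,a))], which do not depend on [x]; summing over [b] gives
    [nA].  Sufficiency: pad [max_x q(b|xy) / nA] to a distribution [r(b|y)] and
    let Alice's output be uniform and Bob's marginal be [r]; all of the weight
    that matters for [q], namely [q(b|xy) / nA], sits on the event [a = z], and
    the remainder [r(b|y) - q(b|xy) / nA >= 0] is spread evenly over [a != z]. *)

Lemma sum_if_eq (V : nmodType) (n : nat) (z : 'I_n) (u v : V) :
  \sum_(a < n) (if a == z then u else v) = u + v *+ n.-1.
Proof.
rewrite (bigD1 z) //= eqxx; congr (_ + _).
rewrite (eq_bigr (fun=> v)) => [|a /negPf-> //].
by rewrite sumr_const cardC1 card_ord.
Qed.

Section Assistance.

Variables (R : realType) (nX nY nB nA : nat).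
Implicit Types (q : pm_family R nX nY nB) (r : 'I_nB -> 'I_nY -> R).

(* For [nA = 1] the division by [nA.-1] is by 0, but the second branch is then
   never taken. *)
Definition aligned_box q r (a : 'I_nA) (b : 'I_nB) (x : 'I_nX)
    (yz : 'I_nY * 'I_nA) : R :=
  if a == yz.2 then q b x yz.1 / nA%:R
  else (r b yz.1 - q b x yz.1 / nA%:R) / nA.-1%:R.

Lemma NS_adaptive_guess_bound q : (0 < nX)%N ->
  NS_adaptive R nX nY nB nA q -> guess_bound nA q.
Proof.
move=> hX [[q0 q1] [p [[p0 p1 pA pB] qE]]] y.
pose x0 := Ordinal hX.
(* The innermost sum is Bob's marginal for input [(y, a)], so the reference input [x0] can stand for
   every [x]; its term [a' = a] is the one occurring in [q]. Summed over [b], each message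
   contributes total mass 1. *)
apply: (@le_trans _ _ (\sum_b \sum_a \sum_a' p a' b x0 (y, a))).
  apply: ler_sum => b _; apply: bigmax_le => [|x _].
    by apply: sumr_ge0 => a _; apply: sumr_ge0.
  rewrite qE; apply: ler_sum => a _.
  by rewrite (pB _ _ _ x) (bigD1 a) //= lerDl sumr_ge0.
rewrite exchange_big /= (eq_bigr (fun=> 1)) => [|a _].
  by rewrite sumr_const card_ord.
by rewrite exchange_big p1.
Qed.

Lemma aligned_boxP q r : (0 < nA)%N -> is_behavior q ->
    (forall y, \sum_b r b y = 1) -> (forall b x y, q b x y / nA%:R <= r b y) ->
  is_NS_box (aligned_box q r).
Proof.
move=> hA [q0 q1] r1 qr.
have nA0 : nA%:R != 0 :> R by rewrite pnatr_eq0 -lt0n.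
have remE x y : \sum_b (r b y - q b x y / nA%:R) = 1 - nA%:R^-1.
  by rewrite sumrB r1 -mulr_suml q1 mul1r.
have predE : nA.-1%:R = nA%:R - 1 :> R.
  by rewrite -[in RHS](prednK hA) -natr1 addrK.
(* With a single message no [a != z] can carry the remainder, so it has to vanish: its terms are
   nonnegative and sum to [1 - 1 / nA = 0]. *)
have rem0 b x y : nA.-1 = 0%N -> r b y - q b x y / nA%:R = 0.
  move=> n1; have nA1 : nA = 1%N by rewrite -(prednK hA) n1.
  move: (remE x y); rewrite {2}nA1 invr1 subrr => /eqP.
  rewrite psumr_eq0 => [/allP/(_ b)|b' _]; last by rewrite subr_ge0.
  by rewrite mem_index_enum => /(_ isT) /eqP.
have margA a x yz : \sum_b aligned_box q r a b x yz = nA%:R^-1.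
  rewrite /aligned_box; case: eqP => [_|az].
    by rewrite -mulr_suml q1 mul1r.
  (* Two distinct messages [a] and [z] exist, hence [nA >= 2]. *)
  have pred0 : nA.-1%:R != 0 :> R.
    rewrite pnatr_eq0; apply/eqP => n1; apply: az.
    have ord_eq0 (i : 'I_nA) : i = 0%N :> nat.
      by apply/eqP; rewrite -leqn0 -n1 -ltnS prednK.
    by apply/val_inj; rewrite /= !ord_eq0.
  rewrite -mulr_suml remE; apply: (mulIf pred0).
  by rewrite mulfVK // predE mulrBr mulVf ?mulr1.
have margB b x yz : \sum_a aligned_box q r a b x yz = r b yz.1.
  rewrite sum_if_eq; have [n1|n1] := eqVneq nA.-1 0%N.
    by apply/esym/eqP; rewrite n1 mulr0n addr0 -subr_eq0 rem0.
  by rewrite -[_ / _ *+ _]mulr_natr mulfVK ?pnatr_eq0 // addrC subrK.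
split.
- move=> a b x yz; rewrite /aligned_box.
  by case: eqP => _; rewrite mulr_ge0 ?invr_ge0 ?ler0n ?subr_ge0.
- move=> x yz; under eq_bigr do rewrite margA.
  by rewrite sumr_const card_ord -[_^-1 *+ _]mulr_natr mulVf.
- by move=> a x yz yz'; rewrite !margA.
- by move=> b yz x x'; rewrite !margB.
Qed.

Lemma guess_bound_NS_adaptive q : (0 < nA)%N -> (0 < nB)%N ->
  is_behavior q -> guess_bound nA q -> NS_adaptive R nX nY nB nA q.
Proof.
move=> hA hB qb qG; split=> //.
have nA0 : 0 < nA%:R :> R by rewrite ltr0n.
pose M b y := \big[Num.max/0]_(x < nX) q b x y / nA%:R.
(* The mass that [M] lacks is shared equally among the [nB] outputs, so [r] sums to 1. The guessing
   bound makes this mass nonnegative, whence [q b x y / nA <= M b y <= r b y]. *)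
pose r b y := M b y + (1 - \sum_b' M b' y) / nB%:R.
exists (aligned_box q r); split; last first.
  move=> b x y; rewrite /aligned_box /=.
  (* Adaptivity sets [z = a], so only the first branch of the box is read, [nA] times. *)
  rewrite (eq_bigr (fun=> q b x y / nA%:R)) => [|a _]; last by rewrite eqxx.
  by rewrite sumr_const card_ord -[_ / _ *+ _]mulr_natr mulfVK ?gt_eqF.
apply: aligned_boxP => // [y|b x y].
  rewrite big_split /= sumr_const card_ord -[_ / _ *+ _]mulr_natr.
  by rewrite mulfVK ?pnatr_eq0 -?lt0n // addrC subrK.
apply: (@le_trans _ _ (M b y)).
  by rewrite ler_pM2r ?invr_gt0 //; apply: le_bigmax.
rewrite lerDl divr_ge0 ?ler0n // subr_ge0 -mulr_suml ler_pdivrMr // mul1r.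
exact: qG.
Qed.

End Assistance.

Theorem mainTheorem3 (R : realType) (nX nY nB nA : nat)
    (hX : (0 < nX)%N) (hY : (0 < nY)%N) (hB : (0 < nB)%N) (hA : (0 < nA)%N) :
  (forall q : pm_family R nX nY nB, is_behavior q ->
     (NS_adaptive R nX nY nB nA q <->
      forall y : 'I_nY,
        \sum_(b < nB) \big[Num.max/0]_(x < nX) q b x y <= nA%:R)) /\
  NS_adaptive R nX nY nB nA = Gset R nX nY nB nA.
Proof.
have NSP q : is_behavior q ->
    NS_adaptive R nX nY nB nA q <-> guess_bound nA q.
  by split; [exact: NS_adaptive_guess_bound | exact: guess_bound_NS_adaptive].
split=> [q /NSP //|]; apply/seteqP; split=> q [qb qP].
  by split=> //; apply/NSP.
by apply/NSP.
Qed.
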